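(* Let $f:\{0,1\}^n\to\{0,1\}$ be a polynomial over $\mathbb{F}_2$ whose degree $\le2$ part is uniformly random. Then $\mathbb{E}_f[\mathrm{ngap}(f)^4]\le3\cdot2^{-2n}$.
   Context: Write $f=f_{>2}+f_{\le2}$, where $f_{>2}$ (the part of degree $>2$) is arbitrary and fixed, and $f_{\le2}(x)=\sum_{i<j}\beta_{ij}x_ix_j+\sum_k\gamma_kx_k\pmod 2$ with all $\beta_{ij},\gamma_k$ independent and uniform in $\{0,1\}$ (a constant term is taken to be zero without affecting the result). The expectation is over the $\beta_{ij},\gamma_k$. Define $\mathrm{gap}(f)=|\{x:f(x)=0\}|-|\{x:f(x)=1\}|$ and $\mathrm{ngap}(f)=\mathrm{gap}(f)/2^n=2^{-n}\sum_{x\in\{0,1\}^n}(-1)^{f(x)}$. *)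

(* Defs.v *)
From mathcomp Require Export all_boot all_order all_algebra.
From mathcomp Require Export mpoly.

Set Implicit Arguments.
Unset Strict Implicit.
Unset Printing Implicit Defensive.

Import Order.TTheory GRing.Theory Num.Theory.

Local Open Scope ring_scope.

Definition cube (n : nat) : finType := {ffun 'I_n -> 'F_2}.

Definition polyfun (n : nat) (p : {mpoly 'F_2[n]}) : cube n -> 'F_2 :=
  fun x => p.@[x].

Definition gap (n : nat) (f : cube n -> 'F_2) : int :=
  #|[set x | f x == 0]|%:Z - #|[set x | f x == 1]|%:Z.

Definition ngap (R : realFieldType) (n : nat) (f : cube n -> 'F_2) : R :=
  (gap f)%:~R / 2 ^+ n.

Definition has_only_degree_gt2 (n : nat) (p : {mpoly 'F_2[n]}) : Prop :=
  forall m : 'X_{1..n}, m \in msupp p -> (2 < mdeg m)%N.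

Definition upair (n : nat) : finType := {ij : 'I_n * 'I_n | (ij.1 < ij.2)%N}.

(* The coefficients (beta, gamma) of f_{<=2}. The counting measure on this
   product, normalized, makes all the beta_ij and gamma_k independent and
   uniform in {0,1}. *)
Definition coefs (n : nat) : finType :=
  ({ffun upair n -> 'F_2} * {ffun 'I_n -> 'F_2})%type.

Definition f_le2 (n : nat) (c : coefs n) : {mpoly 'F_2[n]} :=
  \sum_(ij : upair n) c.1 ij *: ('X_(val ij).1 * 'X_(val ij).2)
  + \sum_(k < n) c.2 k *: 'X_k.

(* Expectation of X under the uniform distribution on a finite type. *)
Definition unif_expect (R : realFieldType) (T : finType) (X : T -> R) : R :=
  (\sum_(t : T) X t) / #|T|%:R.

(* Main.v *)
Require Import Defs.
From mathcomp Require Import all_boot all_order all_algebra.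
From mathcomp Require Import mpoly.
From mathcomp Require Import ring lra.

Set Implicit Arguments.
Unset Strict Implicit.
Unset Printing Implicit Defensive.

Import Order.TTheory GRing.Theory Num.Theory.
Local Open Scope ring_scope.

(** Expand the fourth power of the character sum over quadruples of points
    (w, x, y, z) of the cube and average over the coefficients first.  The phase
    is linear in the coefficients, so the average vanishes unless every x_i x_j
    (i < j) and every x_k sums to zero over the quadruple.  With u = x - w and
    v = y - w this forces z = w + u + v and u_i v_j = v_i u_j, that is, u and v
    are linearly dependent over F_2: u = 0, v = 0 or u = v.  The quadruple thus
    splits into two pairs of equal points, and there are at most 3 * 4^n such
    quadruples. *)

Definition sgnF2 (R : pzRingType) (a : 'F_2) : R := (-1) ^+ (a == 1).

Lemma F2P (a : 'F_2) : a = 0 \/ a = 1.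
Proof. by case: a => [[|[|m]] lt_m] //; [left | right]; apply: val_inj. Qed.

Lemma sgnF2D (R : pzRingType) (a b : 'F_2) :
  sgnF2 R (a + b) = sgnF2 R a * sgnF2 R b.
Proof.
by case: (F2P a) => ->; case: (F2P b) => ->;
  rewrite /sgnF2 /= ?mulr1 ?mul1r ?mulrNN ?mulr1.
Qed.

Lemma sgnF2_sum (R : comPzRingType) (I : finType) (a : I -> 'F_2) :
  sgnF2 R (\sum_i a i) = \prod_i sgnF2 R (a i).
Proof. by apply: (big_morph _ (@sgnF2D R)). Qed.

Lemma normr_sgnF2 (R : numDomainType) (a : 'F_2) : `|sgnF2 R a| = 1.
Proof. exact: normr_sign. Qed.

Lemma gap_sgnF2 (R : pzRingType) (n : nat) (f : cube n -> 'F_2) :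
  (gap f)%:~R = \sum_x sgnF2 R (f x).
Proof.
rewrite /gap rmorphB /= -!pmulrn -!sum1_card !natr_sum -sumrN.
rewrite big_mkcond [X in _ + X]big_mkcond -big_split /=.
apply: eq_bigr => x _; rewrite !inE.
by case: (F2P (f x)) => ->; rewrite /sgnF2 /= ?addr0 ?add0r.
Qed.

Lemma sum_F2_sgnF2 (R : pzRingType) (a : 'F_2) :
  \sum_(b : 'F_2) sgnF2 R (b * a) = (a == 0)%:R * 2.
Proof.
rewrite big_ord_recl big_ord1 /=.
by case: (F2P a) => ->; rewrite /sgnF2 /= ?mul1r ?mul0r ?subrr.
Qed.

(** Orthogonality of characters: the sum factors into one two-term sum per coordinate, and a
    coordinate with [a i = 1] contributes the factor 1 - 1 = 0. *)
Lemma sum_sgnF2_linear (R : comPzRingType) (I : finType) (a : I -> 'F_2) :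
  \sum_(c : {ffun I -> 'F_2}) sgnF2 R (\sum_i c i * a i)
  = [forall i, a i == 0]%:R * #|{ffun I -> 'F_2}|%:R.
Proof.
under eq_bigr do rewrite sgnF2_sum.
rewrite -(bigA_distr_bigA (fun i b => sgnF2 R (b * a i))) /=.
under eq_bigr do rewrite sum_F2_sgnF2.
rewrite big_split /= prodr_const card_ffun card_ord natrX; congr (_ * _).
case: forallP => [a0 | /forallP]; first by rewrite big1 // => i _; rewrite a0.
rewrite negb_forall => /existsP[i /negbTE ai].
by rewrite (bigD1 i) //= ai mul0r.
Qed.

Lemma meval_f_le2 (n : nat) (c : coefs n) (x : cube n) :
  (f_le2 c).@[x]
  = \sum_(ij : upair n) c.1 ij * (x (val ij).1 * x (val ij).2)
    + \sum_(k < n) c.2 k * x k.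
Proof.
rewrite /f_le2 mevalD !rmorph_sum /=.
congr (_ + _); apply: eq_bigr => i _; first by rewrite mevalZ mevalM !mevalXU.
by rewrite mevalZ mevalXU.
Qed.

Definition sum4 (n : nat) (h : cube n -> 'F_2) (w x y z : cube n) : 'F_2 :=
  h w + h x + h y + h z.

(** Exactly the condition that the phase, as a linear form in the coefficients, is identically
    zero. *)
Definition moments0 (n : nat) (w x y z : cube n) : bool :=
  [forall ij : upair n,
     sum4 (fun t => t (val ij).1 * t (val ij).2) w x y z == 0]
  && [forall k : 'I_n, sum4 (fun t => t k) w x y z == 0].

Lemma sum_coefs_sgnF2 (R : comPzRingType) (n : nat) (w x y z : cube n) :
  \sum_(c : coefs n) sgnF2 R (sum4 (fun t => (f_le2 c).@[t]) w x y z)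
  = (moments0 w x y z)%:R * #|coefs n|%:R.
Proof.
pose A (ij : upair n) := sum4 (fun t => t (val ij).1 * t (val ij).2) w x y z.
pose B (k : 'I_n) := sum4 (fun t => t k) w x y z.
have phase (c : coefs n) : sum4 (fun t => (f_le2 c).@[t]) w x y z
    = \sum_ij c.1 ij * A ij + \sum_k c.2 k * B k.
  rewrite /sum4 !meval_f_le2.
  under [X in _ = X + _]eq_bigr do rewrite !mulrDr.
  under [X in _ = _ + X]eq_bigr do rewrite !mulrDr.
  by rewrite !big_split /=; ring.
under eq_bigr do rewrite phase sgnF2D.
rewrite -(pair_bigA _
  (fun (c1 : {ffun upair n -> 'F_2}) (c2 : {ffun 'I_n -> 'F_2}) =>
    sgnF2 R (\sum_ij c1 ij * A ij) * sgnF2 R (\sum_k c2 k * B k))) /=.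
rewrite -big_distrlr /= !sum_sgnF2_linear card_prod /moments0 -mulnb !natrM.
by ring.
Qed.

Lemma moments0_paired (n : nat) (w x y z : cube n) : moments0 w x y z ->
  [|| (w == x) && (y == z), (w == y) && (x == z) | (w == z) && (x == y)].
Proof.
case/andP => /forallP quad /forallP lin.
have zE k : z k = w k + x k + y k.
  have := lin k; rewrite /sum4.
  by case: (F2P (w k)) (F2P (x k)) (F2P (y k)) (F2P (z k))
    => -> [] -> [] -> [] -> // _; apply/eqP.
(* With x = w + u, y = w + v and z = w + u + v, everything in the quadratic moment cancels mod 2
   except u_i v_j + v_i u_j. *)
have dep_lt (i j : 'I_n) : (i < j)%N ->
    (x i - w i) * (y j - w j) = (y i - w i) * (x j - w j).
  move=> lt_ij; have := quad (exist _ (i, j) lt_ij : upair n).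
  rewrite /sum4 /= !zE.
  by case: (F2P (w i)) (F2P (x i)) (F2P (y i)) => -> [] -> [] ->;
    case: (F2P (w j)) (F2P (x j)) (F2P (y j)) => -> [] -> [] -> // _; apply/eqP.
have dep (i j : 'I_n) : (x i - w i) * (y j - w j) = (y i - w i) * (x j - w j).
  case: (ltngtP i j) => [/dep_lt // | /dep_lt e | /val_inj ->].
    by rewrite mulrC -e mulrC.
  exact: mulrC.
have [wx | w_neq_x] := eqVneq w x.
  apply/orP; left; apply/eqP/ffunP => k; rewrite zE -wx.
  by case: (F2P (w k)) (F2P (y k)) => -> [] ->; apply/eqP.
(* A coordinate with u_i = 1 turns the vanishing minors into v_j = v_i u_j for all j, so v is the
   multiple v_i of u: either 0 or u itself. *)
have /existsP[i xi] : [exists i, x i != w i].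
  apply: contraR w_neq_x => /existsPn xw.
  by apply/eqP/ffunP => k; apply/esym/eqP; rewrite -[_ == _]negbK xw.
have ui : x i - w i = 1.
  by case: (F2P (x i - w i)) => // /eqP; rewrite subr_eq0 (negbTE xi).
have vE j : y j - w j = (y i - w i) * (x j - w j) by rewrite -dep ui mul1r.
case: (F2P (y i - w i)) => e.
  have yw : w = y.
    by apply/ffunP => j; apply/esym/eqP; rewrite -subr_eq0 vE e mul0r.
  apply/orP; right; apply/orP; left; rewrite yw eqxx; apply/eqP/ffunP => k.
  by rewrite zE yw; case: (F2P (y k)) (F2P (x k)) => -> [] ->; apply/eqP.
have xy : x = y.
  by apply/ffunP => j; apply: (addIr (- w j)); rewrite vE e mul1r.
apply/orP; right; apply/orP; right; rewrite xy eqxx andbT; apply/eqP/ffunP => k.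
by rewrite zE xy; case: (F2P (y k)) (F2P (w k)) => -> [] ->; apply/eqP.
Qed.

Lemma sum_pred1 (R : pzSemiRingType) (T : finType) (a : T) :
  \sum_(t : T) (a == t)%:R = 1 :> R.
Proof.
rewrite (bigD1 a) //= eqxx big1 ?addr0 // => t /negbTE.
by rewrite eq_sym => ->.
Qed.

Lemma sum_moments0_le (R : realFieldType) (n : nat) :
  \sum_(w : cube n) \sum_(x : cube n) \sum_(y : cube n) \sum_(z : cube n)
    (moments0 w x y z)%:R <= 3 * 2 ^+ (2 * n) :> R.
Proof.
pose d (s t : cube n) : R := (s == t)%:R.
have card_cube : #|cube n|%:R = 2 ^+ n :> R.
  by rewrite card_ffun !card_ord natrX.
have sumd s : \sum_t d s t = 1 by apply: sum_pred1.
have sumc (a : R) : \sum_(t : cube n) a = 2 ^+ n * a.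
  by rewrite sumr_const -card_cube mulr_natl.
(* Union bound over the three pairings. Each pairing imposes two equalities and leaves two free
   points, hence contributes 4^n; quadruples of equal points are counted three times, which only
   weakens the bound. *)
apply: (@le_trans _ _ (\sum_w \sum_x \sum_y \sum_z
    (d w x * d y z + d w y * d x z + d w z * d x y))).
  do 4 apply: ler_sum => ? _.
  case: (boolP (moments0 _ _ _ _)) => [/moments0_paired | _].
    by rewrite /d; do 6 case: eqP => _ //=; lra.
  by rewrite !addr_ge0 // mulr_ge0.
have inner w x y : \sum_z (d w x * d y z + d w y * d x z + d w z * d x y)
    = d w x + d w y + d x y.
  by rewrite !big_split /= -!mulr_sumr -mulr_suml !sumd !mulr1 mul1r.
under eq_bigr do under eq_bigr do under eq_bigr do rewrite inner.
under eq_bigr do under eq_bigr do rewrite !big_split /= sumc !sumd.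
under eq_bigr do rewrite !big_split /= -mulr_sumr sumd !sumc.
rewrite sumc mulnC exprM; by rewrite le_eqVlt; apply/orP; left; apply/eqP; ring.
Qed.

Lemma sum_pow4 (R : comPzRingType) (T : finType) (F : T -> R) :
  (\sum_t F t) ^+ 4 = \sum_w \sum_x \sum_y \sum_z F w * F x * F y * F z.
Proof.
apply/esym.
under eq_bigr do under eq_bigr do under eq_bigr do rewrite -mulr_sumr.
under eq_bigr do under eq_bigr do rewrite -mulr_suml -mulr_sumr.
under eq_bigr do rewrite -!mulr_suml -mulr_sumr.
by rewrite -!mulr_suml; ring.
Qed.

Theorem lemma12 (R : realFieldType) (n : nat) (f_gt2 : {mpoly 'F_2[n]})
    (f_gt2_deg : has_only_degree_gt2 f_gt2) :
  unif_expect (fun c : coefs n => ngap R (polyfun (f_gt2 + f_le2 c)) ^+ 4)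
    <= 3 * 2 ^- (2 * n).
Proof.
pose s (t : cube n) := sgnF2 R f_gt2.@[t].
have N_gt0 : 0 < #|coefs n|%:R :> R.
  by rewrite card_prod !card_ffun card_ord ltr0n muln_gt0 !expn_gt0.
(* The signs [s] come from the fixed high-degree part, so they factor out of the sum over [c], which
   is moved innermost. *)
have moment : \sum_c (gap (polyfun (f_gt2 + f_le2 c)))%:~R ^+ 4
    = \sum_(w : cube n) \sum_(x : cube n) \sum_(y : cube n) \sum_(z : cube n)
        s w * s x * s y * s z * ((moments0 w x y z)%:R * #|coefs n|%:R) :> R.
  under eq_bigr do rewrite gap_sgnF2 sum_pow4.
  rewrite exchange_big /=; apply: eq_bigr => w _.
  rewrite exchange_big /=; apply: eq_bigr => x _.
  rewrite exchange_big /=; apply: eq_bigr => y _.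
  rewrite exchange_big /=; apply: eq_bigr => z _.
  rewrite -sum_coefs_sgnF2 mulr_sumr; apply: eq_bigr => c _.
  by rewrite /polyfun /sum4 !mevalD !sgnF2D /s; ring.
have bound : \sum_c (gap (polyfun (f_gt2 + f_le2 c)))%:~R ^+ 4
    <= 3 * 2 ^+ (2 * n) * #|coefs n|%:R :> R.
  rewrite moment; apply: le_trans (ler_wpM2r (ltW N_gt0) (sum_moments0_le R n)).
  do 4 (rewrite mulr_suml; apply: ler_sum => ? _).
  (* The signs have absolute value 1, so passing to absolute values removes the high-degree part
     whatever it is. *)
  apply: le_trans (ler_norm _) _.
  by rewrite !normrM !normr_sgnF2 !mul1r !ger0_norm // ltW.
rewrite /unif_expect /ngap; under eq_bigr do rewrite expr_div_n.
rewrite -mulr_suml ler_pdivrMr // ler_pdivrMr ?exprn_gt0 //.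
apply: le_trans bound _; rewrite mulnC exprM.
have : (2 : R) ^+ n != 0 by rewrite expf_neq0 // pnatr_eq0.
(* What remains is an identity in p = 2^n: the normalization by p^4 turns the count 3 p^2 into 3
   p^(-2). *)
move: (2 ^+ n) => p p0.
by rewrite le_eqVlt; apply/orP; left; apply/eqP; field.
Qed.
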